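(* Let $R$ be a ring, $\sigma$ an endomorphism of $R$, $M_R$ a right $R$-module, and $n\geq 2$ an integer. Then: (1) $M_R$ is $\sigma$-skew McCoy if and only if $M[x;\sigma]/M[x;\sigma](x^n)$ is $\overline{\sigma}$-skew McCoy (as a right $R[x;\sigma]/(x^n)$-module). (2) $R$ is $\sigma$-skew McCoy if and only if $R[x;\sigma]/(x^n)$ is $\overline{\sigma}$-skew McCoy. (3) $M_R$ is McCoy if and only if $M[x]/M[x](x^n)$ is McCoy (as a right $R[x]/(x^n)$-module). (4) $R$ is McCoy if and only if $R[x]/(x^n)$ is McCoy.
   Context: Rings are associative with unity; modules are right modules. For an endomorphism $\sigma$ of a ring $R$, $R[x;\sigma]$ is the skew polynomial ring of polynomials $\sum a_ix^i$ with coefficients on the left and $xa=\sigma(a)x$ for $a\in R$. For a right $R$-module $M$, $M[x;\sigma]=\{\sum_{i=0}^p m_ix^i\mid p\ge 0,\ m_i\in M\}$ is the right $R[x;\sigma]$-module with obvious addition and action $(mx^j)(ax^{\ell})=m\sigma^j(a)x^{j+\ell}$. When $\sigma=\mathrm{id}_R$ one writes $R[x]$, $M[x]$. $M_R$ is called $\sigma$-skew McCoy if whenever $m(x)g(x)=0$ with $m(x)\in M[x;\sigma]$ and $g(x)\in R[x;\sigma]\setminus\{0\}$, there exists $a\in R\setminus\{0\}$ with $m(x)a=0$. $M_R$ is McCoy if it is $\mathrm{id}_R$-skew McCoy. A ring is called $\sigma$-skew McCoy (respectively McCoy) if it is so as a right module over itself. $(x^n)$ is the ideal of $R[x;\sigma]$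 (or $R[x]$) generated by $x^n$, and $M[x;\sigma](x^n)$ is the submodule of $M[x;\sigma]$ generated by $x^n$, i.e. the set of elements of $M[x;\sigma]$ all of whose coefficients in degree $<n$ vanish; the quotient $M[x;\sigma]/M[x;\sigma](x^n)$ is a right module over $R[x;\sigma]/(x^n)$. The endomorphism $\overline{\sigma}$ of $R[x;\sigma]/(x^n)$ is induced by $\sum a_ix^i\mapsto\sum\sigma(a_i)x^i$. In checking the McCoy-type property over $R[x;\sigma]/(x^n)$, the (skew) polynomials are taken in a new indeterminate. *)

(* Defs.v *)
From HB Require Import structures.
From mathcomp Require Import all_boot all_algebra.
From mathcomp Require Import finmap boolp monalg.

Set Implicit Arguments.
Unset Strict Implicit.
Unset Printing Implicit Defensive.

Import GRing.Theory.
Local Open Scope ring_scope.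
Local Open Scope quotient_scope.

(* A right A-module is an [lmodType A^c], where A^c is the converse ring: the
   action of a on v is then the left scaling by a seen in A^c.  The regular
   right module A_A is [(A^c)^o]. *)
Definition ract (A : pzRingType) (V : lmodType A^c) (v : V) (a : A) : V :=
  (a : A^c) *: v.

Reserved Notation "v <* a" (at level 40, left associativity).
Notation "v <* a" := (ract v a) : ring_scope.

Section RightAction.
Variables (A : pzRingType) (V : lmodType A^c).
Implicit Types (u v : V) (a b : A).

Lemma ract1 v : v <* 1 = v.
Proof. exact: scale1r. Qed.

Lemma ractA v a b : v <* a <* b = v <* (a * b).
Proof. exact: (@scalerA A^c). Qed.

Lemma ract_is_zmod_morphism v : zmod_morphism (ract v).
Proof. by move=> a b; exact: (@scalerBl A^c). Qed.

HB.instance Definition _ v :=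
  GRing.isZmodMorphism.Build A V (ract v) (ract_is_zmod_morphism v).

Lemma ractDl u v a : (u + v) <* a = u <* a + v <* a.
Proof. exact: scalerDr. Qed.

Lemma ractDr v a b : v <* (a + b) = v <* a + v <* b.
Proof. exact: raddfD. Qed.

Lemma ractNl v a : (- v) <* a = - (v <* a).
Proof. exact: scalerN. Qed.

Lemma ractNr v a : v <* (- a) = - (v <* a).
Proof. exact: raddfN. Qed.

Lemma ractBl u v a : (u - v) <* a = u <* a - v <* a.
Proof. exact: scalerBr. Qed.

Lemma ractBr v a b : v <* (a - b) = v <* a - v <* b.
Proof. exact: raddfB. Qed.

Lemma ract0 v : v <* 0 = 0.
Proof. exact: raddf0. Qed.

Lemma ract0l a : (0 : V) <* a = 0.
Proof. exact: scaler0. Qed.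

Lemma ract_suml (I : Type) (r : seq I) (P : pred I) (F : I -> V) a :
  (\sum_(i <- r | P i) F i) <* a = \sum_(i <- r | P i) F i <* a.
Proof. exact: scaler_sumr. Qed.

Lemma ract_sumr (I : Type) (r : seq I) (P : pred I) v (F : I -> A) :
  v <* (\sum_(i <- r | P i) F i) = \sum_(i <- r | P i) v <* F i.
Proof. exact: raddf_sum. Qed.

End RightAction.

Lemma ract_regular (A : pzRingType) (v : (A^c)^o) (a : A) :
  v <* a = (v : A) * a.
Proof. by []. Qed.


Section EndoIter.
Variables (R : pzRingType) (s : {rmorphism R -> R}).

Definition endo_iter (i : nat) : R -> R := iter i s.

Lemma endo_iter_is_zmod_morphism i : zmod_morphism (endo_iter i).
Proof.
by elim: i => [|i IH] a b //; rewrite -[LHS]/(s (endo_iter i _)) IH rmorphB.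
Qed.

Lemma endo_iter_is_monoid_morphism i : monoid_morphism (endo_iter i).
Proof.
elim: i => [|i [IH1 IHm]]; first by [].
split=> [|a b]; rewrite -[LHS]/(s (endo_iter i _)); first by rewrite IH1 rmorph1.
by rewrite IHm rmorphM.
Qed.

HB.instance Definition _ i :=
  GRing.isZmodMorphism.Build R R (endo_iter i) (endo_iter_is_zmod_morphism i).
HB.instance Definition _ i :=
  GRing.isMonoidMorphism.Build R R (endo_iter i)
    (endo_iter_is_monoid_morphism i).

Lemma endo_iter0 a : endo_iter 0 a = a.
Proof. by []. Qed.

Lemma endo_iterS i a : endo_iter i.+1 a = s (endo_iter i a).
Proof. by []. Qed.

Lemma endo_iterD i j a : endo_iter (i + j) a = endo_iter i (endo_iter j a).
Proof. exact: iterD. Qed.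

Lemma endo_iterSr i a : endo_iter i.+1 a = endo_iter i (s a).
Proof. exact: iterSr. Qed.

End EndoIter.

(* The carriers of R[x;s] and M[x;s] are the finitely supported families of
   coefficients; [<< a *g i >>] is the monomial a x^i and [f@_i] the
   coefficient of x^i in f. *)
Definition skewpoly (R : pzRingType) (s : {rmorphism R -> R}) : Type :=
  {malg R[nat]}.
Definition skewmod (R : pzRingType) (s : {rmorphism R -> R})
  (M : lmodType R^c) : Type := {malg M[nat]}.

HB.instance Definition _ (R : pzRingType) (s : {rmorphism R -> R}) :=
  GRing.Zmodule.on (skewpoly s).
HB.instance Definition _ (R : pzRingType) (s : {rmorphism R -> R})
  (M : lmodType R^c) := GRing.Zmodule.on (skewmod s M).

Lemma sum_fset_ord (V : zmodType) (S : {fset nat}) (G : nat -> V) n :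
  (forall i, i \notin S -> G i = 0) ->
  \sum_(i <- S | (i < n)%N) G i = \sum_(i < n) G i.
Proof.
move=> G0; rewrite -(big_mkord xpredT G).
rewrite [RHS](bigID (mem S)) /= [X in _ = _ + X]big1 => [|i /G0 //].
rewrite addr0 -[LHS]big_filter -[RHS]big_filter; apply: perm_big.
apply: uniq_perm; [exact/filter_uniq/fset_uniq | exact/filter_uniq/iota_uniq|].
by move=> i; rewrite !mem_filter mem_index_iota andbC.
Qed.

Section SkewAction.
Variables (R : pzRingType) (s : {rmorphism R -> R}) (M : lmodType R^c).
Implicit Types (m : skewmod s M) (f g : skewpoly s).

Local Notation endo := (endo_iter s).

(* The biadditive extension of (m x^i)(a x^j) = m s^i(a) x^(i+j). *)
Definition skew_act m f : skewmod s M :=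
  \sum_(i <- msupp m) \sum_(j <- msupp f)
    << (m@_i <* endo i f@_j) *g (i + j)%N >>.

Lemma coef_skew_act m f k :
  (skew_act m f)@_k = \sum_(i < k.+1) m@_(i : nat) <* endo i f@_(k - i)%N.
Proof.
pose G i := m@_(i : nat) <* endo i f@_(k - i)%N.
rewrite -[RHS](@sum_fset_ord _ (msupp m) G); last first.
  by move=> i /mcoeff_outdom mi0; rewrite /G mi0 ract0l.
rewrite /skew_act raddf_sum /= [RHS]big_mkcond /=; apply: eq_bigr => i _.
rewrite raddf_sum /=; case: ltnP => [lt_ik | lt_ki].
  rewrite (eq_bigr (fun j => if j == (k - i)%N then G i else 0)); last first.
    move=> j _; rewrite mcoeffU; have -> : (i + j == k)%N = (j == k - i)%N.
      by rewrite -[RHS](eqn_add2l i) subnKC.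
    by case: eqP => // ->.
  have [kiP|kiN] := boolP ((k - i)%N \in msupp f).
    rewrite (bigD1_seq _ kiP (fset_uniq _)) eqxx /= big1 ?addr0 // => j.
    by move/negPf->.
  by rewrite big1 ?/G ?(mcoeff_outdom kiN) ?raddf0 ?ract0 // => j _; case: eqP.
apply: big1 => j _; rewrite mcoeffU; case: eqP => // def_k.
by rewrite -def_k ltnNge leq_addr in lt_ki.
Qed.

End SkewAction.

Section SkewPolyRing.
Variables (R : pzRingType) (s : {rmorphism R -> R}).
Implicit Types (f g h : skewpoly s).

Local Notation endo := (endo_iter s).

Definition skew_one : skewpoly s := << 1 *g 0%N >>.

Definition skew_mul f g : skewpoly s :=
  \sum_(i <- msupp f) \sum_(j <- msupp g)
    << (f@_i * endo i g@_j) *g (i + j)%N >>.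

Lemma skew_mulE f g : skew_mul f g = skew_act (M := (R^c)^o) f g.
Proof. by []. Qed.

Lemma coef_skew_mul f g k :
  (skew_mul f g)@_k = \sum_(i < k.+1) f@_(i : nat) * endo i g@_(k - i)%N.
Proof. exact: (@coef_skew_act R s (R^c)^o). Qed.

Lemma coef_skew_one k : skew_one@_k = (k == 0%N)%:R.
Proof. by rewrite mcoeffU eq_sym. Qed.

Lemma skew_actA (M : lmodType R^c) (m : skewmod s M) f g :
  skew_act (skew_act m f) g = skew_act m (skew_mul f g).
Proof.
apply/malgP => k; rewrite !coef_skew_act.
pose F j i := m@_j <* endo j f@_(i - j)%N <* endo i g@_(k - i)%N.
transitivity (\sum_(i < k.+1) \sum_(j < k.+1 | (j <= i)%N) F j i).
  apply: eq_bigr => i _; rewrite coef_skew_act ract_suml.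
  by rewrite (big_ord_widen k.+1 (fun j : nat => F j i)) ?ltn_ord.
rewrite (exchange_big_dep predT) //=; apply: eq_bigr => j _.
rewrite coef_skew_mul raddf_sum ract_sumr /=.
rewrite -(big_mkord (fun i => j <= i)%N (F j)).
rewrite (big_cat_nat (leq0n j)) /=; last exact: ltnW.
rewrite big_nat_cond big_pred0 ?add0r; last first.
  by move=> i; rewrite ltnNge; case: (j <= i)%N; rewrite ?andbF.
rewrite -{1}[nat_of_ord j]add0n big_addn big_mkcond /= subSn; last first.
  by rewrite -ltnS ltn_ord.
rewrite big_mkord; apply: eq_bigr => i _.
rewrite leq_addl /F addnK rmorphM -ractA; congr (_ <* _).
by rewrite addnC endo_iterD subnDA.
Qed.

Lemma skew_act1 (M : lmodType R^c) (m : skewmod s M) : skew_act m skew_one = m.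
Proof.
apply/malgP => k; rewrite coef_skew_act big_ord_recr /= subnn coef_skew_one.
rewrite rmorph1 ract1 big1 ?add0r // => i _.
by rewrite coef_skew_one subn_eq0 leqNgt ltn_ord raddf0 ract0.
Qed.

Lemma skew_actDl (M : lmodType R^c) (m1 m2 : skewmod s M) f :
  skew_act (m1 + m2) f = skew_act m1 f + skew_act m2 f.
Proof.
apply/malgP => k; rewrite mcoeffD !coef_skew_act -big_split.
by apply: eq_bigr => i _; rewrite /= mcoeffD ractDl.
Qed.

Lemma skew_actDr (M : lmodType R^c) (m : skewmod s M) f g :
  skew_act m (f + g) = skew_act m f + skew_act m g.
Proof.
apply/malgP => k; rewrite mcoeffD !coef_skew_act -big_split.
by apply: eq_bigr => i _; rewrite /= mcoeffD raddfD ractDr.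
Qed.

Lemma skew_mulA : associative skew_mul.
Proof. by move=> f g h; exact/esym/(@skew_actA (R^c)^o). Qed.

Lemma skew_mul1l : left_id skew_one skew_mul.
Proof.
move=> f; apply/malgP => k; rewrite coef_skew_mul big_ord_recl /= subn0.
by rewrite coef_skew_one mul1r big1 ?addr0 // => i _; rewrite mcoeffU mul0r.
Qed.

Lemma skew_mul1r : right_id skew_one skew_mul.
Proof. by move=> f; exact: (@skew_act1 (R^c)^o). Qed.

Lemma skew_mulDl : left_distributive skew_mul +%R.
Proof. by move=> f g h; exact: (@skew_actDl (R^c)^o). Qed.

Lemma skew_mulDr : right_distributive skew_mul +%R.
Proof. by move=> f g h; exact: (@skew_actDr (R^c)^o). Qed.

HB.instance Definition _ := GRing.Zmodule_isPzRing.Build (skewpoly s)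
  skew_mulA skew_mul1l skew_mul1r skew_mulDl skew_mulDr.

Definition skewC (a : R) : skewpoly s := << a *g 0%N >>.
Definition skewX : skewpoly s := << 1 *g 1%N >>.

Lemma coef_skewM f g k :
  (f * g)@_k = \sum_(i < k.+1) f@_(i : nat) * endo i g@_(k - i)%N.
Proof. exact: coef_skew_mul. Qed.

Lemma coef_skewC a k : (skewC a)@_k = if k == 0%N then a else 0.
Proof. by rewrite mcoeffU eq_sym; case: eqP. Qed.

Lemma skewU_mul (a b : R) i j :
  (<< a *g i >> : skewpoly s) * << b *g j >> = << a * endo i b *g (i + j)%N >>.
Proof.
apply/malgP => k; rewrite coef_skewM mcoeffU.
have [<-|ne_k] := (i + j)%N =P k; last first.
  rewrite big1 // => -[l ltlk] _ /=; rewrite !mcoeffU.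
  case: (i =P l) => [il|_]; last by rewrite mul0r.
  case: (j =P (k - l)%N) => [jl|_]; last by rewrite raddf0 mulr0.
  by case: ne_k; rewrite il jl subnKC.
have lti : (i < (i + j).+1)%N by rewrite ltnS leq_addr.
rewrite (bigD1 (Ordinal lti)) //= addKn !mcoeffUU big1 ?addr0 // => l.
rewrite -val_eqE /= => ne_li; rewrite mcoeffU eq_sym (negPf ne_li).
by rewrite mul0r.
Qed.

Lemma skewXC a : skewX * skewC a = skewC (s a) * skewX.
Proof. by rewrite !skewU_mul mul1r mulr1. Qed.

Lemma skewXn n : skewX ^+ n = << 1 *g n >>.
Proof.
elim: n => // n IHn; rewrite exprS IHn skewU_mul mul1r rmorph1.
by rewrite add1n.
Qed.

Lemma skewUE (a : R) n : << a *g n >> = skewC a * skewX ^+ n.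
Proof. by rewrite skewXn skewU_mul mulr1. Qed.

End SkewPolyRing.

HB.instance Definition _ (R : pzRingType) (s : {rmorphism R -> R})
    (M : lmodType R^c) :=
  GRing.Zmodule_isLmodule.Build (skewpoly s)^c (skewmod s M)
    (fun f g m => skew_actA m g f)
    (@skew_act1 R s M)
    (fun f m1 m2 => skew_actDl m1 m2 f)
    (fun m f g => skew_actDr m f g).

Lemma coef_skew_ract (R : pzRingType) (s : {rmorphism R -> R})
    (M : lmodType R^c) (m : skewmod s M) (f : skewpoly s) k :
  (m <* f)@_k = \sum_(i < k.+1) m@_(i : nat) <* endo_iter s i f@_(k - i)%N.
Proof. exact: coef_skew_act. Qed.

(* The two-sided ideal (x) = A x A of a noncommutative ring A. *)
Definition principal_ideal (A : pzRingType) (x : A) : {pred A} :=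
  fun y => `[< exists r : seq (A * A), y = \sum_(p <- r) p.1 * x * p.2 >].

(* V (x): the submodule of sums of products of an element of V and an element
   of (x). *)
Definition principal_submod (A : pzRingType) (V : lmodType A^c) (x : A) :
    {pred V} :=
  fun v => `[< exists2 r : seq (V * A),
    forall p, p \in r -> p.2 \in principal_ideal x &
    v = \sum_(p <- r) p.1 <* p.2 >].
Arguments principal_submod {A} V x _.

Section PrincipalIdeal.
Variables (A : pzRingType) (x : A).
Implicit Types (y z a : A).

Lemma principal_idealP y :
  reflect (exists r : seq (A * A), y = \sum_(p <- r) p.1 * x * p.2)
          (y \in principal_ideal x).
Proof. exact: asboolP. Qed.

Lemma principal_ideal_zmod_closed : zmod_closed (principal_ideal x).
Proof.
split; first by apply/principal_idealP; exists [::]; rewrite big_nil.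
move=> y z /principal_idealP[r ->] /principal_idealP[t ->].
apply/principal_idealP; exists (r ++ [seq (- p.1, p.2) | p <- t]).
rewrite big_cat big_map -sumrN; congr (_ + _).
by apply: eq_bigr => p _; rewrite !mulNr.
Qed.

HB.instance Definition _ :=
  GRing.isZmodClosed.Build A (principal_ideal x) principal_ideal_zmod_closed.

Lemma principal_ideal_gen : x \in principal_ideal x.
Proof.
by apply/principal_idealP; exists [:: (1, 1)]; rewrite big_seq1 mul1r mulr1.
Qed.

Lemma principal_idealMl a y :
  y \in principal_ideal x -> a * y \in principal_ideal x.
Proof.
move=> /principal_idealP[r ->]; apply/principal_idealP.
exists [seq (a * p.1, p.2) | p <- r]; rewrite big_map mulr_sumr.
by apply: eq_bigr => p _; rewrite !mulrA.
Qed.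

Lemma principal_idealMr a y :
  y \in principal_ideal x -> y * a \in principal_ideal x.
Proof.
move=> /principal_idealP[r ->]; apply/principal_idealP.
exists [seq (p.1, p.2 * a) | p <- r]; rewrite big_map mulr_suml.
by apply: eq_bigr => p _; rewrite !mulrA.
Qed.

End PrincipalIdeal.

Section PrincipalSubmod.
Variables (A : pzRingType) (V : lmodType A^c) (x : A).
Implicit Types (u v : V) (a : A).

Lemma principal_submodP v :
  reflect (exists2 r : seq (V * A),
             forall p, p \in r -> p.2 \in principal_ideal x &
             v = \sum_(p <- r) p.1 <* p.2)
          (v \in principal_submod V x).
Proof. exact: asboolP. Qed.

Lemma principal_submod_zmod_closed : zmod_closed (principal_submod V x).
Proof.
split; first by apply/principal_submodP; exists [::]; rewrite ?big_nil.
move=> u v /principal_submodP[r rx ->] /principal_submodP[t tx ->].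
apply/principal_submodP; exists (r ++ [seq (- p.1, p.2) | p <- t]).
  by move=> p; rewrite mem_cat => /orP[/rx //|/mapP[q /tx ? ->]].
rewrite big_cat big_map -sumrN; congr (_ + _).
by apply: eq_bigr => p _; rewrite ractNl.
Qed.

HB.instance Definition _ := GRing.isZmodClosed.Build V (principal_submod V x)
  principal_submod_zmod_closed.

Lemma principal_submod_act v a :
  a \in principal_ideal x -> v <* a \in principal_submod V x.
Proof.
move=> ax; apply/principal_submodP; exists [:: (v, a)]; last by rewrite big_seq1.
by move=> p; rewrite inE => /eqP->.
Qed.

Lemma principal_submodM v a :
  v \in principal_submod V x -> v <* a \in principal_submod V x.
Proof.
move=> /principal_submodP[r rx ->]; rewrite ract_suml big_seq.
apply: rpred_sum => p /rx px; rewrite ractA.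
exact/principal_submod_act/principal_idealMr.
Qed.

End PrincipalSubmod.

Definition quot_ring (A : pzRingType) (x : A) : Type :=
  {ideal_quot principal_ideal x}.
Definition quot_mod (A : pzRingType) (V : lmodType A^c) (x : A) : Type :=
  {ideal_quot principal_submod V x}.
Arguments quot_mod {A} V x.

Section QuotRing.
Variables (A : pzRingType) (x : A).
Local Notation Q := (quot_ring x).

HB.instance Definition _ := GRing.Zmodule.on Q.

Definition quot_ring_pi (a : A) : Q := \pi_{ideal_quot principal_ideal x} a.
Definition quot_ring_repr (q : Q) : A :=
  repr (q : {ideal_quot principal_ideal x}).

Lemma quot_ring_reprK : cancel quot_ring_repr quot_ring_pi.
Proof. exact: reprK. Qed.

Lemma quot_ring_piE a b :
  (quot_ring_pi a == quot_ring_pi b) = (a - b \in principal_ideal x).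
Proof. by rewrite Quotient.idealrBE. Qed.

Lemma quot_ring_pi_is_zmod_morphism : zmod_morphism quot_ring_pi.
Proof. by move=> a b; rewrite /quot_ring_pi raddfB. Qed.

HB.instance Definition _ := GRing.isZmodMorphism.Build A Q quot_ring_pi
  quot_ring_pi_is_zmod_morphism.

Definition quot_ring_one : Q := quot_ring_pi 1.
Definition quot_ring_mul (p q : Q) : Q :=
  quot_ring_pi (quot_ring_repr p * quot_ring_repr q).

Lemma quot_ring_pi_mul a b :
  quot_ring_pi (a * b) = quot_ring_mul (quot_ring_pi a) (quot_ring_pi b).
Proof.
set a' := quot_ring_repr (quot_ring_pi a).
set b' := quot_ring_repr (quot_ring_pi b).
have Ia : a - a' \in principal_ideal x.
  by rewrite -quot_ring_piE quot_ring_reprK.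
have Ib : b - b' \in principal_ideal x.
  by rewrite -quot_ring_piE quot_ring_reprK.
apply/eqP; rewrite quot_ring_piE -/a' -/b'.
have -> : a * b - a' * b' = (a - a') * b + a' * (b - b').
  by rewrite mulrBl mulrBr addrA subrK.
by apply: rpredD; [apply: principal_idealMr | apply: principal_idealMl].
Qed.

Lemma quot_ring_mulA : associative quot_ring_mul.
Proof.
move=> p q r; rewrite -[p]quot_ring_reprK -[q]quot_ring_reprK.
by rewrite -[r]quot_ring_reprK -!quot_ring_pi_mul mulrA.
Qed.

Lemma quot_ring_mul1l : left_id quot_ring_one quot_ring_mul.
Proof.
by move=> p; rewrite -[p]quot_ring_reprK -quot_ring_pi_mul mul1r.
Qed.

Lemma quot_ring_mul1r : right_id quot_ring_one quot_ring_mul.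
Proof.
by move=> p; rewrite -[p]quot_ring_reprK -quot_ring_pi_mul mulr1.
Qed.

Lemma quot_ring_mulDl : left_distributive quot_ring_mul +%R.
Proof.
move=> p q r; rewrite -[p]quot_ring_reprK -[q]quot_ring_reprK.
by rewrite -[r]quot_ring_reprK -raddfD -!quot_ring_pi_mul mulrDl raddfD.
Qed.

Lemma quot_ring_mulDr : right_distributive quot_ring_mul +%R.
Proof.
move=> p q r; rewrite -[p]quot_ring_reprK -[q]quot_ring_reprK.
by rewrite -[r]quot_ring_reprK -raddfD -!quot_ring_pi_mul mulrDr raddfD.
Qed.

HB.instance Definition _ := GRing.Zmodule_isPzRing.Build Q
  quot_ring_mulA quot_ring_mul1l quot_ring_mul1r
  quot_ring_mulDl quot_ring_mulDr.

Lemma quot_ring_pi_is_monoid_morphism : monoid_morphism quot_ring_pi.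
Proof. by split=> // a b; rewrite quot_ring_pi_mul. Qed.

HB.instance Definition _ := GRing.isMonoidMorphism.Build A Q quot_ring_pi
  quot_ring_pi_is_monoid_morphism.

End QuotRing.

Section QuotMod.
Variables (A : pzRingType) (V : lmodType A^c) (x : A).
Local Notation Q := (quot_ring x).
Local Notation W := (quot_mod V x).

HB.instance Definition _ := GRing.Zmodule.on W.

Definition quot_mod_pi (v : V) : W := \pi_{ideal_quot principal_submod V x} v.
Definition quot_mod_repr (w : W) : V :=
  repr (w : {ideal_quot principal_submod V x}).

Lemma quot_mod_reprK : cancel quot_mod_repr quot_mod_pi.
Proof. exact: reprK. Qed.

Lemma quot_mod_piE u v :
  (quot_mod_pi u == quot_mod_pi v) = (u - v \in principal_submod V x).
Proof. by rewrite Quotient.idealrBE. Qed.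

Lemma quot_mod_pi_is_zmod_morphism : zmod_morphism quot_mod_pi.
Proof. by move=> u v; rewrite /quot_mod_pi raddfB. Qed.

HB.instance Definition _ := GRing.isZmodMorphism.Build V W quot_mod_pi
  quot_mod_pi_is_zmod_morphism.

Definition quot_mod_act (w : W) (q : Q) : W :=
  quot_mod_pi (quot_mod_repr w <* quot_ring_repr q).

Lemma quot_mod_pi_act v a :
  quot_mod_pi (v <* a) = quot_mod_act (quot_mod_pi v) (quot_ring_pi x a).
Proof.
set v' := quot_mod_repr (quot_mod_pi v).
set a' := quot_ring_repr (quot_ring_pi x a).
have Iv : v - v' \in principal_submod V x.
  by rewrite -quot_mod_piE quot_mod_reprK.
have Ia : a - a' \in principal_ideal x.
  by rewrite -quot_ring_piE quot_ring_reprK.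
apply/eqP; rewrite quot_mod_piE -/v' -/a'.
have -> : v <* a - v' <* a' = (v - v') <* a + v' <* (a - a').
  by rewrite ractBl ractBr addrA subrK.
by apply: rpredD; [apply: principal_submodM | apply: principal_submod_act].
Qed.

Lemma quot_mod_actA (p q : Q) (w : W) :
  quot_mod_act (quot_mod_act w q) p = quot_mod_act w (q * p).
Proof.
rewrite -[p]quot_ring_reprK -[q]quot_ring_reprK -[w]quot_mod_reprK.
by rewrite -rmorphM -!quot_mod_pi_act ractA.
Qed.

Lemma quot_mod_act1 (w : W) : quot_mod_act w 1 = w.
Proof.
rewrite -[w]quot_mod_reprK -(rmorph1 (quot_ring_pi x)).
by rewrite -quot_mod_pi_act ract1.
Qed.

Lemma quot_mod_actDl (q : Q) (u w : W) :
  quot_mod_act (u + w) q = quot_mod_act u q + quot_mod_act w q.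
Proof.
rewrite -[q]quot_ring_reprK -[u]quot_mod_reprK -[w]quot_mod_reprK.
by rewrite -raddfD -!quot_mod_pi_act ractDl raddfD.
Qed.

Lemma quot_mod_actDr (w : W) (p q : Q) :
  quot_mod_act w (p + q) = quot_mod_act w p + quot_mod_act w q.
Proof.
rewrite -[p]quot_ring_reprK -[q]quot_ring_reprK -[w]quot_mod_reprK.
by rewrite -raddfD -!quot_mod_pi_act ractDr raddfD.
Qed.

HB.instance Definition _ := GRing.Zmodule_isLmodule.Build Q^c W
  quot_mod_actA quot_mod_act1 quot_mod_actDl quot_mod_actDr.

Lemma quot_mod_pi_ract v a :
  quot_mod_pi (v <* a) = quot_mod_pi v <* quot_ring_pi x a.
Proof. exact: quot_mod_pi_act. Qed.

End QuotMod.

Section TruncatedSkew.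
Variables (R : pzRingType) (s : {rmorphism R -> R}).

Definition trunc_ring (n : nat) : pzRingType :=
  quot_ring (skewX s ^+ n).
Definition trunc_mod (M : lmodType R^c) (n : nat) :
    lmodType (trunc_ring n)^c :=
  quot_mod (skewmod s M) (skewX s ^+ n).

Definition skew_map (f : skewpoly s) : skewpoly s :=
  \sum_(i <- msupp f) << s f@_i *g i >>.

Lemma coef_skew_map f i : (skew_map f)@_i = s f@_i.
Proof.
rewrite raddf_sum /= (eq_bigr (fun j => if j == i then s f@_i else 0)).
  have [iP|iN] := boolP (i \in msupp f).
    rewrite (bigD1_seq _ iP (fset_uniq _)) eqxx /= big1 ?addr0 // => j.
    by move/negPf->.
  by rewrite big1 ?(mcoeff_outdom iN) ?rmorph0 // => j _; case: eqP.
by move=> j _; rewrite mcoeffU; case: eqP => // ->.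
Qed.

Lemma skew_map_is_zmod_morphism : zmod_morphism skew_map.
Proof.
by move=> f g; apply/malgP => i; rewrite mcoeffB !coef_skew_map mcoeffB rmorphB.
Qed.

Lemma skew_map_is_monoid_morphism : monoid_morphism skew_map.
Proof.
split=> [|f g]; apply/malgP => i; rewrite coef_skew_map.
  by rewrite !coef_skew_one rmorph_nat.
rewrite !coef_skewM rmorph_sum; apply: eq_bigr => j _.
by rewrite rmorphM !coef_skew_map -endo_iterS endo_iterSr.
Qed.

HB.instance Definition _ := GRing.isZmodMorphism.Build (skewpoly s) (skewpoly s)
  skew_map skew_map_is_zmod_morphism.
HB.instance Definition _ := GRing.isMonoidMorphism.Build
  (skewpoly s) (skewpoly s) skew_map skew_map_is_monoid_morphism.

Lemma skew_mapX : skew_map (skewX s) = skewX s.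
Proof.
apply/malgP => i; rewrite coef_skew_map !mcoeffU.
by case: eqP; rewrite ?rmorph1 ?rmorph0.
Qed.

Variable n : nat.

Lemma skew_map_ideal f : f \in principal_ideal (skewX s ^+ n) ->
  skew_map f \in principal_ideal (skewX s ^+ n).
Proof.
move=> /principal_idealP[r ->]; rewrite rmorph_sum.
apply: rpred_sum => p _; rewrite !rmorphM rmorphXn /= skew_mapX.
exact/principal_idealMr/principal_idealMl/principal_ideal_gen.
Qed.

Definition trunc_endo (q : trunc_ring n) : trunc_ring n :=
  quot_ring_pi _ (skew_map (quot_ring_repr q)).

Lemma trunc_endo_pi f :
  trunc_endo (quot_ring_pi _ f) = quot_ring_pi _ (skew_map f).
Proof.
apply/eqP; rewrite quot_ring_piE -rmorphB; apply: skew_map_ideal.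
by rewrite -quot_ring_piE quot_ring_reprK.
Qed.

Lemma trunc_endo_is_zmod_morphism : zmod_morphism trunc_endo.
Proof.
move=> p q; rewrite -[p]quot_ring_reprK -[q]quot_ring_reprK.
by rewrite -raddfB !trunc_endo_pi !raddfB.
Qed.

Lemma trunc_endo_is_monoid_morphism : monoid_morphism trunc_endo.
Proof.
split=> [|p q].
  by rewrite -(rmorph1 (quot_ring_pi _)) trunc_endo_pi !rmorph1.
rewrite -[p]quot_ring_reprK -[q]quot_ring_reprK.
by rewrite -rmorphM !trunc_endo_pi !rmorphM.
Qed.

HB.instance Definition _ := GRing.isZmodMorphism.Build
  (trunc_ring n) (trunc_ring n) trunc_endo trunc_endo_is_zmod_morphism.
HB.instance Definition _ := GRing.isMonoidMorphism.Build
  (trunc_ring n) (trunc_ring n) trunc_endo trunc_endo_is_monoid_morphism.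

End TruncatedSkew.

Arguments trunc_ring {R} s n.
Arguments trunc_mod {R} s M n.
Arguments trunc_endo {R} s n q.

(* The relation x a = s(a) x makes R[x;s] x^n two-sided, so the generated
   submodule and ideal are cut out by their coefficients of degree < n. *)
Lemma mem_skewXn_submod (R : pzRingType) (s : {rmorphism R -> R})
    (M : lmodType R^c) n (m : skewmod s M) :
  reflect (forall i, (i < n)%N -> m@_i = 0)
          (m \in principal_submod (skewmod s M) (skewX s ^+ n)).
Proof.
have coefXn0 (f : skewpoly s) k : f \in principal_ideal (skewX s ^+ n) ->
    (k < n)%N -> f@_k = 0.
  move=> /principal_idealP[r ->] ltkn; rewrite raddf_sum big1 //= => -[f1 f2] _.
  rewrite coef_skewM big1 //= => i _; rewrite coef_skewM big1 ?mul0r //= => j _.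
  rewrite skewXn mcoeffU; case: eqP => [def_n|_]; last by rewrite raddf0 mulr0.
  have: (i - j < n)%N.
    by apply: leq_ltn_trans ltkn; rewrite (leq_trans (leq_subr _ _)) // -ltnS.
  by rewrite -def_n ltnn.
apply: (iffP idP) => [/principal_submodP[r rx ->] k ltkn | m0].
  rewrite raddf_sum big_seq big1 //= => p /rx /coefXn0 p0.
  rewrite coef_skew_ract big1 // => i _; rewrite p0 ?raddf0 ?ract0 //.
  exact: leq_ltn_trans (leq_subr _ _) ltkn.
pose xn : skewpoly s := skewX s ^+ n.
apply/principal_submodP; exists [seq (<< m@_i *g (i - n)%N >> : skewmod s M, xn) | i <- msupp m].
  by move=> p /mapP[i _ ->]; apply: principal_ideal_gen.
rewrite big_map {1}[m]monalgE; apply: eq_big_seq => i im /=.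
have leni : (n <= i)%N.
  by rewrite leqNgt; apply: contraL im => /m0 mi0; rewrite -mcoeff_eq0 mi0.
apply/malgP => k; rewrite coef_skew_ract mcoeffU.
have [<-|/eqP ne_ik] := i =P k; last first.
  rewrite big1 // => j _; rewrite mcoeffU /xn skewXn mcoeffU.
  case: ((i - n)%N =P j) => [def_j|_]; last by rewrite ract0l.
  case: (n =P (k - j)%N) => [def_n|_]; last by rewrite raddf0 ract0.
  by case/eqP: ne_ik; rewrite -(subnK leni) def_j {1}def_n subnKC // -ltnS.
have ltj : (i - n < i.+1)%N by rewrite ltnS leq_subr.
rewrite (bigD1 (Ordinal ltj)) //= /xn skewXn mcoeffUU mcoeffU subKn // eqxx.
rewrite rmorph1 ract1 big1 ?addr0 // => j; rewrite -val_eqE /= => ne_j.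
by rewrite mcoeffU eq_sym (negPf ne_j) ract0l.
Qed.

Lemma mem_skewXn_ideal (R : pzRingType) (s : {rmorphism R -> R}) n
    (f : skewpoly s) :
  reflect (forall i, (i < n)%N -> f@_i = 0)
          (f \in principal_ideal (skewX s ^+ n)).
Proof.
pose P := @mem_skewXn_submod R s (R^c)^o n f.
apply: (iffP idP) => [fI | /P /principal_submodP[r rx ->]].
  apply/P/principal_submodP; exists [:: (1 : skewpoly s, f)].
    by move=> p; rewrite inE => /eqP->.
  by rewrite big_seq1; apply/esym; apply: (mul1r (f : skewpoly s)).
rewrite big_seq; apply: rpred_sum => p /rx px; exact: principal_idealMl.
Qed.

Section McCoy.
Variable R : pzRingType.

Definition skew_McCoy (s : {rmorphism R -> R}) (M : lmodType R^c) : Prop :=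
  forall (m : skewmod s M) (g : skewpoly s),
    g != 0 -> m <* g = 0 -> exists2 a : R, a != 0 & m <* skewC s a = 0.

(* M[x] and R[x] are the case s = id of M[x;s] and R[x;s]. *)
Definition McCoy (M : lmodType R^c) : Prop := skew_McCoy idfun M.

Definition skew_McCoy_ring (s : {rmorphism R -> R}) : Prop :=
  skew_McCoy s (R^c)^o.

Definition McCoy_ring : Prop := McCoy (R^c)^o.

End McCoy.

Arguments McCoy {R} M.

(* Main.v *)
(* Filter by degree in x.  Let m(y)g(y) = 0 over the truncated ring, with g
   nonzero, and let k < n be minimal such that the coefficients of x^k in g form
   a nonzero skew polynomial g_k(y) over R.  The coefficient of x^k in m(y)g(y)
   is m_0(y)g_k(y), so the McCoy property of M gives c != 0 killing m_0(y), and
   then c x^(n-1) kills m(y).  Conversely, an a(x) != 0 killing a skew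
   polynomial with constant coefficients does so coefficientwise, so any nonzero
   coefficient of a(x) kills it as well. *)
Require Import Defs.
From HB Require Import structures.
From mathcomp Require Import all_boot all_algebra.
From mathcomp Require Import finmap monalg zify.

Set Implicit Arguments.
Unset Strict Implicit.
Unset Printing Implicit Defensive.

Import GRing.Theory.
Local Open Scope ring_scope.

(** [phi 0 = 0] keeps the support finite; [phi] may be any such map, since it will read coefficients
    off the set-theoretic sections [rA] and [rV]. *)
Lemma malg_map_exists (K : choiceType) (G H : zmodType) (phi : G -> H)
    (f : {malg G[K]}) :
  phi 0 = 0 -> exists g : {malg H[K]}, forall k, g@_k = phi f@_k.
Proof.
move=> phi0; exists [malg k in msupp f => phi f@_k] => k.
by rewrite mcoeffE; case: (msuppP f k) => // _; rewrite phi0.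
Qed.

(** Only the constant term of [skewC s a] contributes, so annihilation by a scalar decouples into
    one twisted condition per coefficient. *)
Lemma skewC_annihP (R : pzRingType) (s : {rmorphism R -> R}) (M : lmodType R^c)
    (m : skewmod s M) (a : R) :
  m <* skewC s a = 0 <-> forall i, m@_i <* endo_iter s i a = 0.
Proof.
have coefE i : (m <* skewC s a)@_i = m@_i <* endo_iter s i a.
  rewrite coef_skew_ract big_ord_recr /= subnn coef_skewC /=.
  rewrite big1 ?add0r // => j _.
  by rewrite coef_skewC subn_eq0 leqNgt ltn_ord raddf0 ract0.
split=> [ma0 i | ma0]; first by rewrite -coefE ma0 mcoeff0.
by apply/malgP => i; rewrite coefE ma0 mcoeff0.
Qed.

Lemma coef_iter_skew_map (R : pzRingType) (s : {rmorphism R -> R}) j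
    (f : skewpoly s) k :
  (endo_iter (@skew_map R s) j f)@_k = endo_iter s j f@_k.
Proof. by elim: j => // j IHj; rewrite !endo_iterS coef_skew_map IHj. Qed.

(* A plays R[x;s]/(x^n).  V is left abstract because [trunc_mod] of the regular
   module R_R and the regular module of [trunc_ring] are distinct types. *)
Section Truncation.
Variables (R : pzRingType) (s : {rmorphism R -> R}) (M : lmodType R^c).
Variables (A : pzRingType) (t : {rmorphism A -> A}) (V : lmodType A^c).
Variables (n : nat) (pA : {additive skewpoly s -> A}) (rA : A -> skewpoly s).
Variables (pV : {additive skewmod s M -> V}) (rV : V -> skewmod s M).
Hypotheses (rAK : cancel rA pA) (rVK : cancel rV pV).
Hypothesis pA_eq0 : forall f, pA f = 0 <-> forall i, (i < n)%N -> f@_i = 0.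
Hypothesis pV_eq0 : forall m, pV m = 0 <-> forall i, (i < n)%N -> m@_i = 0.
Hypothesis pV_ract : forall m f, pV (m <* f) = pV m <* pA f.
Hypothesis t_pA : forall f, t (pA f) = pA (skew_map f).

Lemma endo_iter_pA j f :
  endo_iter t j (pA f) = pA (endo_iter (@skew_map R s) j f).
Proof. by elim: j => // j IHj; rewrite !endo_iterS IHj t_pA. Qed.

(** The section [rA] need not send 0 to 0; only the coefficients that survive truncation are forced
    to vanish. *)
Lemma rA0 k : (k < n)%N -> (rA 0)@_k = 0.
Proof. by move: k; apply/pA_eq0; exact: rAK. Qed.

Lemma rV0 k : (k < n)%N -> (rV 0)@_k = 0.
Proof. by move: k; apply/pV_eq0; exact: rVK. Qed.

Lemma rA_neq0 (a : A) : a != 0 -> exists2 k, (k < n)%N & (rA a)@_k != 0.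
Proof.
move=> a0; suff /existsP[k]: [exists k : 'I_n, (rA a)@_(k : nat) != 0].
  by exists k.
apply: contra_neqT a0; rewrite negb_exists => /forallP ra0.
rewrite -[a]rAK; apply/pA_eq0 => i lt_in.
by apply/eqP; rewrite -[_ == _]negbK (ra0 (Ordinal lt_in)).
Qed.

Lemma skew_McCoy_of_trunc : (0 < n)%N -> skew_McCoy t V -> skew_McCoy s M.
Proof.
move=> n0 McV m g g0 mg0.
(* View [m] and [g] over the truncation, each coefficient being constant in x. *)
have [m' m'E] : exists m' : skewmod t V,
    forall j, m'@_j = pV << m@_j *g 0%N >>.
  apply: (@malg_map_exists _ _ _ (fun v : M => pV << v *g 0%N >>)).
  by rewrite monalgU0 raddf0.
have [g' g'E] : exists g' : skewpoly t, forall j, g'@_j = pA (skewC s g@_j).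
  apply: (@malg_map_exists _ _ _ (fun a => pA (skewC s a))).
  by rewrite /skewC monalgU0 raddf0.
have g'0 : g' != 0.
  apply: contra_neq g0 => g'0; apply/malgP => j; rewrite mcoeff0.
  have /pA_eq0/(_ 0%N n0) : pA (skewC s g@_j) = 0 by rewrite -g'E g'0 mcoeff0.
  by rewrite coef_skewC.
have mg'0 : m' <* g' = 0.
  apply/malgP => l; rewrite coef_skew_ract mcoeff0.
  under eq_bigr => i _ do rewrite m'E g'E endo_iter_pA -pV_ract.
  rewrite -raddf_sum; apply/pV_eq0 => i lt_in; rewrite raddf_sum /=.
  (* Constants in x multiply to constants, so only degree 0 matters, and there the sum is the
     coefficient of [m <* g] in degree [l]. *)
  have [->|i0] := eqVneq i 0%N; last first.
    apply: big1 => j _; rewrite coef_skew_ract big1 // => p _.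
    rewrite mcoeffU; case: eqP => [p0|_]; last by rewrite ract0l.
    by rewrite coef_iter_skew_map coef_skewC -p0 subn0 (negPf i0) !raddf0.
  transitivity (m <* g)@_l; last by rewrite mg0 mcoeff0.
  rewrite coef_skew_ract; apply: eq_bigr => j _.
  by rewrite coef_skew_ract big_ord1 /= mcoeffUU coef_iter_skew_map coef_skewC.
have [a a0 /skewC_annihP ma0] := McV _ _ g'0 mg'0.
have [k lt_kn ak0] := rA_neq0 a0.
exists (rA a)@_k => //; apply/skewC_annihP => j.
(* As [m'] is constant in x, the degree [k] part of the relation involves only the degree [k]
   coefficient of [a]. *)
have := ma0 j; rewrite m'E -[a in endo_iter t j a]rAK endo_iter_pA -pV_ract.
move=> /pV_eq0/(_ k lt_kn); rewrite coef_skew_ract big_ord_recl /= subn0.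
rewrite mcoeffUU coef_iter_skew_map big1 ?addr0 // => i _.
by rewrite mcoeffU ract0l.
Qed.

Lemma trunc_of_skew_McCoy : skew_McCoy s M -> skew_McCoy t V.
Proof.
move=> McM m g g0 mg0.
have [k [[lt_kn [i gik0]] min_k]] : exists k,
    [/\ (k < n)%N, exists i, (rA g@_i)@_k != 0
      & forall l, (l < k)%N -> forall i, (rA g@_i)@_l = 0].
  (* Searching the finite support of [g] makes the condition boolean, as [ex_minnP] requires; off
     the support, [rA0] supplies the vanishing. *)
  pose P k := (k < n)%N && has (fun i => (rA g@_i)@_k != 0) (msupp g).
  have exP : exists k, P k.
    have [i gi0] : exists i, g@_i != 0.
      have [supp0|] := eqVneq (msupp g) fset0.
        case/eqP: g0; apply/malgP => i.
        by rewrite mcoeff_outdom ?mcoeff0 // supp0.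
      by case/fset0Pn => i ig; exists i; rewrite mcoeff_neq0.
    have [k lt_kn gik0] := rA_neq0 gi0.
    exists k; rewrite /P lt_kn; apply/hasP; exists i => //.
    by rewrite -mcoeff_neq0.
  case: (ex_minnP exP) => k /andP[lt_kn /hasP[i _ gik0]] min_k.
  exists k; split=> // [|l lt_lk j]; first by exists i.
  have lt_ln := ltn_trans lt_lk lt_kn.
  have [jg|/mcoeff_outdom->] := boolP (j \in msupp g); last exact: rA0.
  apply: contraTeq lt_lk => gjl0; rewrite -leqNgt min_k // /P lt_ln.
  by apply/hasP; exists j.
have n0 : (0 < n)%N := leq_ltn_trans (leq0n k) lt_kn.
have [gk gkE] : exists gk : skewpoly s, forall j, gk@_j = (rA g@_j)@_k.
  exact: @malg_map_exists _ _ _ (fun a => (rA a)@_k) g (rA0 lt_kn).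
have [m0 m0E] : exists m0 : skewmod s M, forall j, m0@_j = (rV m@_j)@_0%N.
  exact: @malg_map_exists _ _ _ (fun v => (rV v)@_0%N) m (rV0 n0).
have gk0 : gk != 0.
  by apply: contra_neq gik0 => gk0; rewrite -gkE gk0 mcoeff0.
have mgk0 : m0 <* gk = 0.
  apply/malgP => l; rewrite mcoeff0.
  have := congr1 (mcoeff l) mg0; rewrite mcoeff0 coef_skew_ract.
  under eq_bigr => j _.
    rewrite -[m@_(j : nat)]rVK -[g@_(l - j)%N]rAK endo_iter_pA -pV_ract; over.
  rewrite -raddf_sum => /pV_eq0/(_ k lt_kn); rewrite raddf_sum /= => <-.
  rewrite coef_skew_ract; apply: eq_bigr => j _.
  rewrite coef_skew_ract big_ord_recl /= subn0 coef_iter_skew_map m0E gkE.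
  (* A term using degree [p + 1] of [m] meets [g] in a degree below [k], where [g] vanishes by
     minimality. *)
  rewrite big1 ?addr0 // => p _; rewrite coef_iter_skew_map min_k.
    by rewrite !raddf0.
  by have := ltn_ord p; rewrite /= /bump /=; lia.
have [c c0 /skewC_annihP mc0] := McM _ _ gk0 mgk0.
(* Multiplying by x^(n-1) pushes every positive degree of [m] past the truncation, leaving only
   [m0], which [c] kills. *)
exists (pA << c *g n.-1 >>).
  apply: contra_neq c0 => /pA_eq0/(_ n.-1); rewrite mcoeffUU; apply.
  by rewrite prednK.
apply/skewC_annihP => j; rewrite -[m@_j]rVK endo_iter_pA -pV_ract.
apply/pV_eq0 => l lt_ln; rewrite coef_skew_ract big_ord_recl /= subn0.
rewrite coef_iter_skew_map mcoeffU big1 ?addr0 => [|p _].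
  case: eqP => _; last by rewrite raddf0 ract0.
  by rewrite mulr1n -m0E mc0.
(* A nonzero term would need [n.-1] to equal [l] minus a positive number, against [l < n]. *)
rewrite coef_iter_skew_map mcoeffU /= /bump /=; case: eqP => [def_n|_].
  by have := ltn_ord p; lia.
by rewrite !raddf0.
Qed.

Lemma skew_McCoy_truncP : (0 < n)%N -> skew_McCoy s M <-> skew_McCoy t V.
Proof.
by move=> n0; split; [exact: trunc_of_skew_McCoy | exact: skew_McCoy_of_trunc].
Qed.

End Truncation.

Section TruncatedQuotient.
Variables (R : pzRingType) (s : {rmorphism R -> R}) (n : nat).
Local Notation xn := (skewX s ^+ n).

Lemma quot_ring_pi_eq0 (f : skewpoly s) :
  quot_ring_pi xn f = 0 <-> forall i, (i < n)%N -> f@_i = 0.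
Proof.
rewrite (rwP eqP) -(raddf0 (quot_ring_pi xn)) quot_ring_piE subr0.
by split=> /mem_skewXn_ideal.
Qed.

Lemma quot_mod_pi_eq0 (M : lmodType R^c) (m : skewmod s M) :
  quot_mod_pi xn m = 0 <-> forall i, (i < n)%N -> m@_i = 0.
Proof.
rewrite (rwP eqP) -(raddf0 (quot_mod_pi xn)) quot_mod_piE subr0.
by split=> /mem_skewXn_submod.
Qed.

Variable t : {rmorphism trunc_ring s n -> trunc_ring s n}.
Hypothesis t_pi :
  forall f, t (quot_ring_pi xn f) = quot_ring_pi xn (skew_map f).
Hypothesis n0 : (0 < n)%N.

(** Keeping [t] abstract covers both [trunc_endo s n] and, when [s] is the identity, the identity of
    the quotient, which is what [McCoy] refers to. *)
Lemma skew_McCoy_trunc_mod (M : lmodType R^c) :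
  skew_McCoy s M <-> skew_McCoy t (trunc_mod s M n).
Proof.
exact: (@skew_McCoy_truncP _ s M _ t (trunc_mod s M n) n (quot_ring_pi xn)
  _ (quot_mod_pi xn) _ (@quot_ring_reprK _ xn) (@quot_mod_reprK _ _ xn)
  quot_ring_pi_eq0 (@quot_mod_pi_eq0 M) (@quot_mod_pi_ract _ _ xn) t_pi n0).
Qed.

(** The ring projection serves as [pA] and [pV] at once; its compatibility with the action is
    multiplicativity. *)
Lemma skew_McCoy_trunc_ring : skew_McCoy_ring s <-> skew_McCoy_ring t.
Proof.
exact: (@skew_McCoy_truncP _ s (R^c)^o _ t ((trunc_ring s n)^c)^o n
  (quot_ring_pi xn) _ (quot_ring_pi xn) _ (@quot_ring_reprK _ xn)
  (@quot_ring_reprK _ xn) quot_ring_pi_eq0 quot_ring_pi_eq0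
  (rmorphM (quot_ring_pi xn)) t_pi n0).
Qed.

End TruncatedQuotient.

Lemma skew_map_id (R : pzRingType) (f : skewpoly (idfun : {rmorphism R -> R})) :
  skew_map f = f.
Proof. by apply/malgP => i; rewrite coef_skew_map. Qed.

Theorem corollary3p5 (R : pzRingType) (s : {rmorphism R -> R})
    (M : lmodType R^c) (n : nat) (hn : (2 <= n)%N) :
  [/\ skew_McCoy s M <-> skew_McCoy (trunc_endo s n) (trunc_mod s M n),
      skew_McCoy_ring s <-> skew_McCoy_ring (trunc_endo s n),
      McCoy M <-> McCoy (trunc_mod (idfun : {rmorphism R -> R}) M n) &
      McCoy_ring R <-> McCoy_ring (trunc_ring (idfun : {rmorphism R -> R}) n)].
Proof.
have n0 : (0 < n)%N := ltnW hn.
split.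
- exact: skew_McCoy_trunc_mod (@trunc_endo_pi R s n) n0 M.
- exact: skew_McCoy_trunc_ring (@trunc_endo_pi R s n) n0.
(* Here [t] is [idfun], induced by [skew_map] because the latter is the identity when [s] is. *)
- by apply: skew_McCoy_trunc_mod => // f; rewrite skew_map_id.
- by apply: skew_McCoy_trunc_ring => // f; rewrite skew_map_id.
Qed.
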